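(* Let $v(n)=\mathbb{V}[G_n/\sqrt n\,]=\mathbb{V}[G_n]/n$ for $n\in\mathbb{N}$, $n\ge1$. Then, as $n\to\infty$, $$v(n)=2-\frac{\pi}{2}-\sqrt{\frac{\pi}{18\,n}}+o\!\left(\frac{1}{\sqrt n}\right),$$ and consequently $\lim_{n\to\infty}v(n)=2-\frac{\pi}{2}$.
   Context: Let $X_1,X_2,\ldots$ be independent random variables, each uniformly distributed on $\{1,2,\ldots,n\}$. The gain is $G_n=\min\{k\in\{1,\ldots,n\}: X_k\le k\}$ (well defined since $X_n\le n$). Its probability mass function is $p_{k,n}=\mathbb{P}(G_n=k)=\frac{k}{n^k}\cdot\frac{(n-1)!}{(n-k)!}$ for $1\le k\le n$. Here $\mathbb{V}$ denotes variance. *)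

(* Defs.v *)
From HB Require Import structures.
From mathcomp Require Export all_boot all_order all_algebra finmap.
From mathcomp Require Export all_classical all_reals all_analysis.

Set Implicit Arguments.
Unset Strict Implicit.
Unset Printing Implicit Defensive.

Export Order.TTheory GRing.Theory Num.Theory.
Export numFieldNormedType.Exports.

Local Open Scope classical_set_scope.
Local Open Scope ring_scope.

Definition mutually_independent (I : choiceType) (d d' : measure_display)
    (T : measurableType d) (T' : measurableType d') (R : realType)
    (P : probability T R) (D : set I) (X : I -> {RV P >-> T'}) : Prop :=
  forall (J : {fset I}) (A : I -> set T'),
    [set` J] `<=` D ->
    (forall i, measurable (A i)) ->
    P (\bigcap_(i in [set` J]) (X i @^-1` A i)) =
    (\prod_(i <- J) P (X i @^-1` A i))%E.

(* The n masses 1/n add up to 1, so this determines the law of X; X may leave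
   {1, ..., n} only on a null set. *)
Definition uniform_upto (d : measure_display) (T : measurableType d)
    (R : realType) (P : probability T R) (n : nat) (X : {RV P >-> nat}) : Prop :=
  forall j : nat, (1 <= j <= n)%N ->
    distribution P X [set j] = (n%:R^-1)%:E.

Arguments mutually_independent [I d d' T T' R] P D X.
Arguments uniform_upto [d T R] P n X.

(* G_n at the outcome w: min {k in {1, ..., n} : X_k(w) <= k}. Starting the
   minimum at n is harmless, since n belongs to that set as soon as X_n(w) <= n
   (see gainP); otherwise, which has probability 0, the value is the least k
   with X_k(w) <= k if there is one, and n if not. *)
Definition gain (T : Type) (X : nat -> T -> nat) (n : nat) (w : T) : nat :=
  \big[minn/n]_(1 <= k < n.+1 | (X k w <= k)%N) k.

Lemma gainP (T : Type) (X : nat -> T -> nat) (n : nat) (w : T) :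
  (0 < n)%N -> (X n w <= n)%N ->
  [/\ (1 <= gain X n w <= n)%N,
      (X (gain X n w) w <= gain X n w)%N
    & forall k, (1 <= k <= n)%N -> (X k w <= k)%N -> (gain X n w <= k)%N].
Proof.
move=> n0 Xn.
have [gb gX] : (1 <= gain X n w <= n)%N /\ (X (gain X n w) w <= gain X n w)%N.
  rewrite /gain big_seq_cond.
  apply: (big_ind (fun m => (1 <= m <= n)%N /\ (X m w <= m)%N)).
  - by rewrite n0 leqnn.
  - by move=> x y Hx Hy; case: (leqP x y).
  - by move=> k /andP[]; rewrite mem_index_iota ltnS.
split=> // k; rewrite -[(k <= n)%N]ltnS -mem_index_iota /gain.
elim: (index_iota _ _) => // a s IH; rewrite inE big_cons => /orP[/eqP <-|ks] Xk.
  by rewrite Xk geq_minl.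
by case: ifP => _; rewrite ?geq_min IH ?orbT.
Qed.

(* Main.v *)
Require Import Defs.
From mathcomp Require Import ring lra measurable_realfun.

(* With q_k = P(G_n > k) = prod_(j <= k) (1 - j/n) and Q = sum_k q_k, one has
   E[G_n] = Q, and (k+1) q_k = n (q_k - q_(k+1)) telescopes to
   E[G_n^2] = 2n - Q; hence v(n) = 2 - Q/n - Q^2/n, and everything reduces to
   Q = sqrt(pi n/2) - 1/3 + o(1).
   Put r_k = prod_(j <= k) (1 + j/n)^-1 and R = sum_k r_k.  The terms of Q and R
   are the terms of the series of e^n below and above the index n, up to the
   factor n!/n^n, so Q + R = n! e^n / n^n.  Since q_k/r_k = prod (1 - j^2/n^2),
   r_k - q_k lies between q_k s_k and r_k s_k with s_k = sum_(j <= k) j^2/n^2;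
   both bounds have telescoping sums, which gives R - Q = 2/3 + O(1/sqrt n).
   Comparison with Gaussian sums, Q <= 1 + sqrt(pi n/2) and
   R >= sqrt(pi n/2) - 1, determines the limit of n! e^n / n^(n + 1/2), and
   monotonicity arguments upgrade it to n! e^n / n^n = sqrt(2 pi n) + o(1). *)

Set Implicit Arguments.
Unset Strict Implicit.
Unset Printing Implicit Defensive.
Local Open Scope classical_set_scope.
Local Open Scope ring_scope.

(** * The law of the gain *)

(** The integral of [|f|] to the power [r] is at most the power [r] of [M] times the finite total
    mass. It supplies the square integrability behind the variance formulas. *)
Lemma bounded_Lfun (d : measure_display) (T : measurableType d) (R : realType)
    (mu : {finite_measure set T -> \bar R}) (f : T -> R) (M r : R) :
  1 <= r -> measurable_fun setT f -> (forall x, `|f x| <= M) ->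
  f \in Lfun mu r%:E.
Proof.
move=> r1 mf fM; have r0 : 0 < r by apply: lt_le_trans r1.
rewrite inE; apply/andP; split; rewrite inE//=.
rewrite /finite_norm unlock poweR_lty//.
apply: (@le_lt_trans _ _ (\int[mu]_x (M `^ r)%:E)%E); last first.
  rewrite integral_cst// lte_mul_pinfty ?lee_fin ?powR_ge0//.
  by rewrite fin_num_fun_lty//; exact: fin_num_measure.
apply: ge0_le_integral => //=.
- apply/measurable_EFinP; apply: (measurableT_comp (measurable_powR _)).
  exact: measurableT_comp.
- move=> x _; rewrite lee_fin ge0_ler_powR// ?nnegrE// ?(ltW r0)//.
  by rewrite (le_trans _ (fM x)).
Qed.

(** For [k < n] the starting value [n] of the minimum already exceeds [k], so only an index [j <= k]
    with [X j w <= j] could bring it down to [k] or below. *)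
Lemma gain_gtP (T : Type) (X : nat -> T -> nat) (n k : nat) (w : T) :
  (k < n)%N ->
  (k < gain X n w)%N <-> (forall j, (1 <= j <= k)%N -> (j < X j w)%N).
Proof.
move=> kn; split=> [kG j /andP[j1 jk]|Xk].
  rewrite ltnNge; apply: contraL kG => Xj; rewrite -leqNgt.
  apply: (leq_trans _ jk).
  have : j \in index_iota 1 n.+1.
    by rewrite mem_index_iota j1 ltnS (leq_trans jk (ltnW kn)).
  rewrite /gain; elim: (index_iota _ _) => // a s IH.
  rewrite inE big_cons => /orP[/eqP <-|js]; first by rewrite Xj geq_minl.
  by case: ifP => _; rewrite ?geq_min IH ?orbT.
rewrite /gain big_seq_cond; apply: (big_ind (fun m => k < m)%N) => //.
  by move=> x y kx ky; rewrite leq_min kx.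
move=> j /andP[]; rewrite mem_index_iota ltnS => /andP[j1 _] Xj.
rewrite ltnNge; apply/negP => jk.
by have := Xk j; rewrite j1 jk ltnNge Xj => /(_ isT).
Qed.

Lemma gain_le (T : Type) (X : nat -> T -> nat) (n : nat) (w : T) :
  (gain X n w <= n)%N.
Proof.
rewrite /gain; elim: (index_iota _ _) => [|a s IH]; first by rewrite big_nil.
by rewrite big_cons; case: ifP => _ //; rewrite geq_min IH orbT.
Qed.

(** Discrete layer-cake formula: a function of the gain becomes a combination of the indicators of
    [k < gain], so that its expectation involves tail probabilities only. *)
Lemma natr_telescope (R : pzRingType) (F : nat -> R) (m n : nat) :
  (m <= n)%N -> \sum_(k < n) (F k.+1 - F k) * (k < m)%:R = F m - F 0%N.
Proof.
move=> mn; rewrite -(telescope_sumr _ (leq0n m)) big_mkord.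
rewrite (big_ord_widen n (fun i => F i.+1 - F i) mn) [RHS]big_mkcond /=.
by apply: eq_bigr => i _; case: ifP; rewrite (mulr1, mulr0).
Qed.

Definition gain_tail (R : realType) (n k : nat) : R :=
  \prod_(1 <= j < k.+1) (1 - j%:R / n%:R).

Section gain_law.
Context (d : measure_display) (T : measurableType d) (R : realType).
Context (P : probability T R) (n : nat) (n0 : (0 < n)%N).

(** The masses of [1, ..., j] add up to [j / n]. With [j = n] they exhaust the total mass, so the
    value [0] is null and the complement can be taken. *)
Lemma uniform_upto_gt (X : {RV P >-> nat}) (j : nat) :
  uniform_upto P n X -> (j <= n)%N ->
  P (X @^-1` [set m | (j < m)%N]) = (1 - j%:R / n%:R)%:E.
Proof.
move=> Xu jn.
have PU k : (k <= n)%N ->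
    P (X @^-1` [set m | (1 <= m <= k)%N]) = (k%:R / n%:R)%:E.
  elim: k => [_|k IH kn].
    rewrite mul0r (_ : [set _ | _] = set0) ?preimage_set0 ?measure0//.
    by apply/seteqP; split => m //=; case: m.
  rewrite (_ : [set _ | _] = [set m | (1 <= m <= k)%N] `|` [set k.+1]); last first.
    apply/seteqP; split => m /=.
      by rewrite [(m <= k.+1)%N]leq_eqVlt ltnS => /andP[-> /predU1P[->|->]]; [right|left].
    by move=> [/andP[-> /leqW->]|->]//=.
  rewrite preimage_setU measureU//.
  - rewrite [X in (X + _)%E](IH (ltnW kn)).
    rewrite [X in (_ + X)%E](Xu k.+1)//.
    by rewrite -EFinD -[in RHS]natr1 mulrDl mul1r.
  - by apply: measurable_funPTI.
  - by apply: measurable_funPTI.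
  - by apply/seteqP; split => w //= [/andP[_]] /[swap] ->; rewrite ltnn.
have n0R : n%:R != 0 :> R by rewrite pnatr_eq0 -lt0n.
have X0 : P (X @^-1` [set 0%N]) = 0%E.
  have : P (X @^-1` [set m | (1 <= m <= n)%N]) = 1%E by rewrite PU// divff.
  have mU : measurable (X @^-1` [set m | (1 <= m <= n)%N]) by apply: measurable_funPTI.
  move=> P1; have := probability_setC P mU; rewrite P1 subee// => PC.
  apply/eqP; rewrite eq_le measure_ge0 andbT -PC.
  apply: le_measure; rewrite ?inE.
  - by apply: measurable_funPTI.
  - exact: measurableC.
  - by move=> w /= ->.
have -> : X @^-1` [set m | (j < m)%N] =
    ~` (X @^-1` [set m | (1 <= m <= j)%N] `|` X @^-1` [set 0%N]).
  apply/seteqP; split => w /=.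
    by move=> jX [/andP[_]|X0w]; [rewrite leqNgt jX|rewrite X0w in jX].
  move=> /not_orP[/negP + /eqP]; rewrite -lt0n => + X0w.
  by rewrite X0w -ltnNge.
rewrite probability_setC; last by apply: measurableU; apply: measurable_funPTI.
rewrite measureU0//; try by apply: measurable_funPTI.
by rewrite [X in (_ - X)%E](PU j jn).
Qed.

Context (X : nat -> {RV P >-> nat})
  (X_uniform : forall k : nat, (1 <= k)%N -> uniform_upto P n (X k))
  (X_indep : mutually_independent P [set k : nat | (1 <= k)%N] X).

Let gain_gt_set k : (k < n)%N ->
  [set w | (k < gain X n w)%N] =
  \bigcap_(i in [set` [fset j in index_iota 1 k.+1]%fset])
     (X i @^-1` [set m | (i < m)%N]).
Proof.
move=> kn; apply/seteqP; split => w /=.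
  move=> /(gain_gtP _ _ kn) Xk j /=.
  by rewrite inE /= mem_index_iota ltnS => /Xk.
move=> Xk; apply/(gain_gtP _ _ kn) => j jk; apply: Xk.
by rewrite /= inE /= mem_index_iota ltnS.
Qed.

Lemma measurable_gain_gt k : (k < n)%N ->
  measurable [set w | (k < gain X n w)%N].
Proof.
move=> kn; rewrite gain_gt_set//; apply: fin_bigcap_measurable => [|i _].
  exact: finite_fset.
by apply: measurable_funPTI.
Qed.

(** Independence is applied to the finite intersection of the events [j < X j], [1 <= j <= k], each
    of probability [1 - j / n]. *)
Lemma probability_gain_gt k : (k < n)%N ->
  P [set w | (k < gain X n w)%N] = (gain_tail R n k)%:E.
Proof.
move=> kn; rewrite /gain_tail gain_gt_set// X_indep//; last first.
  by move=> j /=; rewrite inE /= mem_index_iota => /andP[].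
rewrite -prodEFin (perm_big (index_iota 1 k.+1))/=; last first.
  by apply: uniq_perm; rewrite ?fset_uniq ?iota_uniq// => j; rewrite !inE.
rewrite !big_seq; apply: eq_bigr => j.
rewrite mem_index_iota ltnS => /andP[j1 jk].
by rewrite uniform_upto_gt ?(leq_trans jk (ltnW kn))//; exact: X_uniform.
Qed.

Let gain_gt k w : R := (k < gain X n w)%N%:R.

Let gain_gtE k : gain_gt k = \1_[set w | (k < gain X n w)%N].
Proof. by apply/funext => w; rewrite indicE mem_setE. Qed.

Let measurable_gain_gtR k : (k < n)%N -> measurable_fun setT (gain_gt k).
Proof.
by move=> kn; rewrite gain_gtE; apply: measurable_indic; exact: measurable_gain_gt.
Qed.

Let gain_sum w (F : nat -> R) : F 0%N = 0 ->
  F (gain X n w) = \sum_(k < n) (F k.+1 - F k) * gain_gt k w.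
Proof. by move=> F0; rewrite natr_telescope ?gain_le// F0 subr0. Qed.

Lemma measurable_gain : measurable_fun setT (fun w => (gain X n w)%:R : R).
Proof.
rewrite (_ : (fun _ => _) =
    fun w => \sum_(k < n) (k.+1%:R - k%:R) * gain_gt k w); last first.
  by apply/funext => w; exact: (gain_sum w (F := fun k => k%:R)).
apply: measurable_sum => k; apply: measurable_funM => //.
exact: measurable_gain_gtR.
Qed.

(** Monotonicity of [F] makes the layer-cake coefficients nonnegative, so the integral passes
    through the finite sum of nonnegative terms. *)
Lemma expectation_gain (F : nat -> R) : F 0%N = 0 ->
  {homo F : j k / (j <= k)%N >-> j <= k} ->
  ('E_P[fun w => F (gain X n w)])%E =
  (\sum_(k < n) (F k.+1 - F k) * gain_tail R n k)%:E.
Proof.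
move=> F0 Fhomo; rewrite unlock.
under eq_integral do rewrite gain_sum// -sumEFin.
rewrite ge0_integral_sum//.
- rewrite -sumEFin; apply: eq_bigr => k _.
  under eq_integral do rewrite EFinM.
  rewrite ge0_integralZl_EFin//; first last.
  + by rewrite subr_ge0 Fhomo.
  + by apply/measurable_EFinP; exact: measurable_gain_gtR.
  + by move=> w _; rewrite lee_fin.
  rewrite gain_gtE integral_indic//; last exact: measurable_gain_gt.
  by rewrite setIT [X in (_ * X)%E]probability_gain_gt// EFinM.
- move=> k; apply/measurable_EFinP; apply: measurable_funM => //.
  exact: measurable_gain_gtR.
- by move=> k w _; rewrite lee_fin mulr_ge0// subr_ge0 Fhomo.
Qed.

Lemma gain_Lfun2 : (fun w => (gain X n w)%:R : R) \in Lfun P 2%:E.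
Proof.
apply: (@bounded_Lfun _ _ _ _ _ n%:R); rewrite ?ler1n//.
- exact: measurable_gain.
- by move=> w; rewrite ger0_norm// ler_nat gain_le.
Qed.

(** The layer-cake formula is used for [k] and for its square, whose increments are [1] and
    [2k + 1]. *)
Lemma variance_gain :
  ('V_P[fun w => (gain X n w)%:R])%E =
  (\sum_(k < n) k.*2.+1%:R * gain_tail R n k
   - (\sum_(k < n) gain_tail R n k) ^+ 2)%:E.
Proof.
rewrite varianceE ?gain_Lfun2//.
rewrite (expectation_gain (F := fun k => k%:R))//; last first.
  by move=> j k jk; rewrite ler_nat.
rewrite [X in 'E_P[X]%E](_ : _ = (fun w => (gain X n w)%:R ^+ 2))//.
rewrite (expectation_gain (F := fun k => k%:R ^+ 2)).
- rewrite -EFin_expe -EFinB; congr (_ - _ ^+ 2)%:E; apply: eq_bigr => k _.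
    congr (_ * _); rewrite -[in RHS]natr1 -addnn natrD -natr1; ring.
  by rewrite -natr1 addrAC subrr add0r mul1r.
- by rewrite expr0n.
- by move=> j k jk; rewrite ler_sqr ?nnegrE// ler_nat.
Qed.

End gain_law.

(** * Tail products and the exponential series *)

Definition rising_tail (R : realType) (n k : nat) : R :=
  \prod_(1 <= j < k.+1) (1 + j%:R / n%:R)^-1.

Definition gain_mean (R : realType) (n : nat) : R := \sum_(k < n) gain_tail R n k.

Definition stirling_ratio (R : realType) (n : nat) : R :=
  n`!%:R / n%:R ^+ n * expR n%:R.

(* Closed form of [sum_(j <= k) (j / n)^2]. *)
Definition sum_sqr_ratio (R : realType) (n k : nat) : R :=
  k%:R * (k%:R + 1) * (2 * k%:R + 1) / (6 * n%:R ^+ 2).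

Section tails.
Context (R : realType) (n : nat) (n0 : (0 < n)%N).
Local Notation q := (gain_tail R n).
Local Notation r := (rising_tail R n).
Local Notation s := (sum_sqr_ratio R n).
Local Notation Q := (gain_mean R n).

Let nR_gt0 : 0 < n%:R :> R. Proof. by rewrite ltr0n. Qed.
Let nR_neq0 : n%:R != 0 :> R. Proof. by rewrite gt_eqF. Qed.

Lemma gain_tail0 : q 0 = 1.
Proof. by rewrite /gain_tail big_nil. Qed.

Lemma gain_tailS k : q k.+1 = q k * (1 - k.+1%:R / n%:R).
Proof. by rewrite /gain_tail big_nat_recr. Qed.

Lemma gain_tail_eq0 k : (n <= k)%N -> q k = 0.
Proof.
elim: k => [|k IH]; first by rewrite leqn0 gtn_eqF.
rewrite leq_eqVlt ltnS gain_tailS => /predU1P[<-|/IH->]; last by rewrite mul0r.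
by rewrite divff// subrr mulr0.
Qed.

(** Factors with [j > n] are negative, but by then the factor [j = n] has made the product zero. *)
Lemma gain_tail_ge0 k : 0 <= q k.
Proof.
have [nk|kn] := leqP n k; first by rewrite gain_tail_eq0.
elim: k kn => [|k IH] kn; first by rewrite gain_tail0.
rewrite gain_tailS mulr_ge0 ?IH ?(ltnW kn)// subr_ge0.
by rewrite ler_pdivrMr// mul1r ler_nat ltnW.
Qed.

Lemma rising_tail0 : r 0 = 1.
Proof. by rewrite /rising_tail big_nil. Qed.

Lemma rising_tailS k : r k.+1 = r k / (1 + k.+1%:R / n%:R).
Proof. by rewrite /rising_tail big_nat_recr. Qed.

Lemma rising_tail_gt0 k : 0 < r k.
Proof.
elim: k => [|k IH]; first by rewrite rising_tail0.
by rewrite rising_tailS divr_gt0// ltr_pwDl// divr_ge0.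
Qed.

Lemma sum_sqr_ratioS k : s k.+1 = s k + (k.+1%:R / n%:R) ^+ 2.
Proof. rewrite /sum_sqr_ratio -natr1; field; exact: nR_neq0. Qed.

Lemma sum_sqr_ratio_ge0 k : 0 <= s k.
Proof.
by rewrite divr_ge0// ?mulr_ge0 ?addr_ge0 ?mulr_ge0// exprn_ge0.
Qed.

(** As [q k / r k] is the product of the [1 - (j / n)^2], this is the inequality
    [prod (1 - x_j) >= 1 - sum x_j]. *)
Lemma rising_sub_gain_le k : r k - q k <= r k * s k.
Proof.
elim: k => [|k IH].
  by rewrite rising_tail0 gain_tail0 subrr mul1r sum_sqr_ratio_ge0.
have := rising_tail_gt0 k.+1; have := sum_sqr_ratio_ge0 k.
have : r k = r k.+1 * (1 + k.+1%:R / n%:R).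
  by rewrite rising_tailS divfK// gt_eqF// ltr_pwDl// divr_ge0.
have := gain_tail_ge0 k.+1; move: IH.
rewrite sum_sqr_ratioS gain_tailS.
have : 0 <= k.+1%:R / n%:R :> R by rewrite divr_ge0.
set c := (k.+1%:R / n%:R).
move: (r k) (r k.+1) (q k) (s k) => rk rk1 qk sk.
move=> c0 IH qk1 rkE sk0 rk10.
(* If [c > 1], the new sum of squares exceeds [1], and [q k.+1 >= 0] suffices; otherwise the
   induction hypothesis may be multiplied by [1 - c >= 0]. *)
have [c1|c1] := leP c 1; last first.
  rewrite (@le_trans _ _ rk1)//; first lra.
  rewrite ler_peMr ?(ltW rk10)//.
  have : 1 <= c ^+ 2 by rewrite expr_ge1 ?(ltW c1).
  lra.
have qlb : rk * (1 - sk) <= qk by lra.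
have : rk * (1 - sk) * (1 - c) <= qk * (1 - c) by rewrite ler_wpM2r ?subr_ge0.
rewrite rkE.
have : 0 <= rk1 * sk * c ^+ 2 by rewrite !mulr_ge0 ?exprn_ge0// ltW.
lra.
Qed.

(** The companion inequality [(1 + sum x_j) * prod (1 - x_j) <= 1]; from [k = n] on it is trivial
    because [q k = 0]. *)
Lemma rising_sub_gain_ge k : q k * s k <= r k - q k.
Proof.
elim: k => [|k IH].
  by rewrite rising_tail0 gain_tail0 subrr mul1r /sum_sqr_ratio !mul0r.
have := rising_tail_gt0 k.+1; have := sum_sqr_ratio_ge0 k.
have : r k = r k.+1 * (1 + k.+1%:R / n%:R).
  by rewrite rising_tailS divfK// gt_eqF// ltr_pwDl// divr_ge0.
have [nk|kn] := leqP n k.+1.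
  by rewrite (gain_tail_eq0 nk) subr0 mul0r => _ _ /ltW.
have := gain_tail_ge0 k; move: IH.
rewrite sum_sqr_ratioS gain_tailS.
have : 0 <= k.+1%:R / n%:R :> R by rewrite divr_ge0.
have : k.+1%:R / n%:R <= 1 :> R by rewrite ler_pdivrMr// mul1r ler_nat ltnW.
set c := (k.+1%:R / n%:R).
move: (r k) (r k.+1) (q k) (s k) => rk rk1 qk sk.
move=> c1 c0 IH qk0 rkE sk0 rk10.
have {}IH : qk * (1 + sk) <= rk1 * (1 + c) by lra.
(* After multiplication by [1 + c], what remains is [(1 - c^2) (1 + sk + c^2) <= 1 + sk], whose two
   sides differ by [sk c^2 + c^4]. *)
rewrite lerBrDl -[X in X + _]mulr1 -mulrDr -mulrA.
rewrite -(@ler_pM2r _ (1 + c)); last by rewrite ltr_pwDl.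
apply: le_trans IH.
rewrite -!mulrA ler_wpM2l//.
have : 0 <= sk * c ^+ 2 by rewrite mulr_ge0// exprn_ge0.
have : 0 <= c ^+ 4 by rewrite exprn_ge0.
lra.
Qed.

(** Telescoping of [(k + 1) q_k = n (q_k - q_(k+1))]. *)
Lemma sum_gain_tail1 m : \sum_(k < m) (k.+1%:R * q k) = n%:R * (1 - q m).
Proof.
elim: m => [|m IH]; first by rewrite big_ord0 gain_tail0 subrr mulr0.
rewrite big_ord_recr/= IH gain_tailS; field; exact: nR_neq0.
Qed.

Lemma sum_gain_tail_ord : \sum_(k < n) (k%:R * q k) = n%:R - Q.
Proof.
have := sum_gain_tail1 n; rewrite gain_tail_eq0// subr0 mulr1 => <-.
rewrite -sumrB; apply: eq_bigr => k _.
by rewrite -natr1 mulrDl mul1r addrK.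
Qed.

Lemma gain_sqr_mean : \sum_(k < n) k.*2.+1%:R * q k = 2 * n%:R - Q.
Proof.
transitivity (2 * (n%:R - Q) + Q); last by ring.
rewrite -sum_gain_tail_ord mulr_sumr -big_split/=; apply: eq_bigr => k _.
rewrite -natr1 -addnn natrD; ring.
Qed.

(** Summation by parts: [6 n q_k s_k = p(k) (q_k - q_(k+1))] with [p(k) = k (2k + 1)]. The three
    polynomials are [p(k) - p(k-1) = 4k - 1], [p(-1) = 1] and [p(m-1)]. *)
Lemma sum_gain_tail_sqr m : \sum_(k < m) (q k * s k) =
  (\sum_(k < m) q k * (4 * k%:R - 1) + 1
   - q m * (2 * m%:R ^+ 2 - 3 * m%:R + 1)) / (6 * n%:R).
Proof.
elim: m => [|m IH].
  by rewrite !big_ord0 gain_tail0 /= -[0%:R]/0; field; exact: nR_neq0.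
rewrite !big_ord_recr/= IH gain_tailS /sum_sqr_ratio.
rewrite -natr1; field; exact: nR_neq0.
Qed.

Lemma sum_gain_tail_sqrE :
  \sum_(k < n) (q k * s k) = 2 / 3 - (5 * Q - 1) / (6 * n%:R).
Proof.
rewrite sum_gain_tail_sqr gain_tail_eq0// mul0r subr0.
have -> : \sum_(k < n) q k * (4 * k%:R - 1) = 4 * (n%:R - Q) - Q.
  rewrite -sum_gain_tail_ord mulr_sumr -sumrB; apply: eq_bigr => k _; ring.
by field; exact: nR_neq0.
Qed.

(** Summation by parts again: [6 n r_k s_k = p(k) (r_(k-1) - r_k)] for [k >= 1], with
    [p(k) = (k + 1) (2k + 1)]. Here [p(k+1) - p(k) = 4k + 5], [p(0) = 1], and [p(m+1)] multiplies
    [r m]. *)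
Lemma sum_rising_tail_sqr m : \sum_(k < m.+1) (r k * s k) =
  (\sum_(k < m.+1) r k * (4 * k%:R + 5) + 1
   - r m * (2 * m%:R ^+ 2 + 7 * m%:R + 6)) / (6 * n%:R).
Proof.
elim: m => [|m IH].
  rewrite !big_ord_recr !big_ord0/= /sum_sqr_ratio rising_tail0 -[0%:R]/0.
  by field; exact: nR_neq0.
rewrite big_ord_recr/= IH [in RHS]big_ord_recr/=.
have -> : r m = r m.+1 * (1 + m.+1%:R / n%:R).
  by rewrite rising_tailS divfK// gt_eqF// ltr_pwDl// divr_ge0.
rewrite /sum_sqr_ratio -[m.+1%:R]natr1.
by field; exact: nR_neq0.
Qed.

Lemma sum_rising_tail_ord m :
  \sum_(k < m.+1) (r k * k%:R) = n%:R * (1 - r m).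
Proof.
elim: m => [|m IH].
  by rewrite big_ord_recr big_ord0 /= rising_tail0 subrr !mulr0 addr0.
rewrite big_ord_recr/= IH.
have -> : r m = r m.+1 * (1 + m.+1%:R / n%:R).
  by rewrite rising_tailS divfK// gt_eqF// ltr_pwDl// divr_ge0.
by field; exact: nR_neq0.
Qed.

Lemma sum_gain_tail_ge m : (n <= m)%N -> \sum_(k < m) q k = Q.
Proof.
move=> nm; rewrite /gain_mean (big_ord_widen m q nm) [RHS]big_mkcond/=.
by apply: eq_bigr => k _; case: ltnP => // /gain_tail_eq0.
Qed.

(** The termwise bound is summed and the negative boundary terms in [r m] are dropped. *)
Lemma rising_sum_sub_mean_le m : (n <= m)%N ->
  \sum_(k < m) r k - Q <= 2 / 3 + (5 * \sum_(k < m) r k + 1) / (6 * n%:R).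
Proof.
case: m => [|m nm]; first by rewrite leqNgt n0.
rewrite -(sum_gain_tail_ge nm) -sumrB.
apply: (@le_trans _ _ (\sum_(k < m.+1) r k * s k)).
  by apply: ler_sum => k _; exact: rising_sub_gain_le.
rewrite sum_rising_tail_sqr.
have -> : \sum_(k < m.+1) r k * (4 * k%:R + 5) =
   4 * (n%:R * (1 - r m)) + 5 * \sum_(k < m.+1) r k.
  rewrite -sum_rising_tail_ord !mulr_sumr -big_split/=.
  by apply: eq_bigr => k _; ring.
set S := \sum_(k < m.+1) r k.
have -> : 2 / 3 + (5 * S + 1) / (6 * n%:R) = (4 * n%:R + 5 * S + 1) / (6 * n%:R).
  by field; exact: nR_neq0.
rewrite ler_pM2r ?invr_gt0 ?mulr_gt0//.
have := rising_tail_gt0 m => rm0.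
have : 0 <= r m * (2 * m%:R ^+ 2 + 7 * m%:R + 6).
  by rewrite mulr_ge0 ?(ltW rm0)// !addr_ge0// mulr_ge0// exprn_ge0.
have := mulr_ge0 (ltW nR_gt0) (ltW rm0).
lra.
Qed.

(** The termwise lower bound is used below [n] only; beyond, [q k = 0] and [r k] is positive. *)
Lemma rising_sum_sub_mean_ge m : (n <= m)%N ->
  2 / 3 - (5 * Q - 1) / (6 * n%:R) <= \sum_(k < m) r k - Q.
Proof.
move=> nm; rewrite -sum_gain_tail_sqrE -(sum_gain_tail_ge nm) -sumrB.
rewrite (big_ord_widen m (fun k => q k * s k) nm) big_mkcond/=.
apply: ler_sum => k _; case: ltnP => [_|nk]; first exact: rising_sub_gain_ge.
by rewrite (gain_tail_eq0 nk) subr0 ltW ?rising_tail_gt0.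
Qed.

(** The terms of index [n - 1] and [n] of the series are equal, both being [n^n / n!]. Starting [q]
    at the former and [r] at the latter makes the two blocks adjacent and disjoint. *)
Lemma gain_tail_exp_coeff k : (k < n)%N ->
  q k = n`!%:R / n%:R ^+ n * exp_coeff n%:R (n - k.+1)%N.
Proof.
elim: k => [|k IH] kn.
  rewrite gain_tail0 /exp_coeff/= subn1.
  rewrite -[in n`!](prednK n0) -[in _ ^+ n](prednK n0) factS natrM exprS prednK//.
  by field; rewrite nR_neq0 expf_neq0// pnatr_eq0 -lt0n fact_gt0.
rewrite gain_tailS IH ?(ltnW kn)// /exp_coeff/=.
rewrite -[(n - k.+1)%N](subnSK kn) factS exprS natrM.
set m := (n - k.+2)%N.
have -> : k.+1%:R = n%:R - m.+1%:R :> R.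
  by rewrite /m subnSK// natrB ?(ltnW kn)// opprB addrC subrK.
field.
by rewrite nR_neq0 !expf_neq0//= pnatr_eq0 -lt0n fact_gt0 /= addrC natr1 pnatr_eq0.
Qed.

Lemma rising_tail_exp_coeff k :
  r k = n`!%:R / n%:R ^+ n * exp_coeff n%:R (n + k)%N.
Proof.
elim: k => [|k IH].
  rewrite rising_tail0 /exp_coeff/= addn0.
  by field; rewrite expf_neq0// pnatr_eq0 -lt0n fact_gt0.
rewrite rising_tailS IH /exp_coeff/= addnS factS exprS natrM.
have -> : (n + k).+1%:R = n%:R + k.+1%:R :> R by rewrite -addnS natrD.
have : n%:R + k.+1%:R != 0 :> R by rewrite -natrD pnatr_eq0 addnS.
move=> nk0; field.
by rewrite nat1r nk0 nR_neq0 expf_neq0//= pnatr_eq0 -lt0n fact_gt0.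
Qed.

(* Both sums are blocks of consecutive terms of the exponential series at n,
   rescaled by n!/n^n. *)
Lemma mean_add_rising_sum m :
  Q + \sum_(k < m) r k = n`!%:R / n%:R ^+ n * series (exp_coeff n%:R) (n + m)%N.
Proof.
rewrite /series/= (big_cat_nat _ (leq_addr m n))//= mulrDr; congr (_ + _).
  rewrite big_mkord mulr_sumr /gain_mean (reindex_inj rev_ord_inj)/=.
  apply: eq_bigr => k _; rewrite gain_tail_exp_coeff ?ltn_subrL//.
  by rewrite subnSK// subKn// ltnW.
rewrite -[X in \big[_/_]_(X <= _ < _) _]add0n big_addn addKn big_mkord mulr_sumr.
by apply: eq_bigr => k _; rewrite rising_tail_exp_coeff addnC.
Qed.

Lemma cvg_rising_sum :
  (fun m => \sum_(k < m) r k) @ \oo --> stirling_ratio R n - Q.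
Proof.
rewrite (_ : (fun m => _) = fun m =>
    n`!%:R / n%:R ^+ n * series (exp_coeff n%:R) (m + n)%N - Q); last first.
  by apply/funext => m; rewrite addnC -mean_add_rising_sum addrAC subrr add0r.
apply: cvgB; last exact: cvg_cst.
apply: cvgM; first exact: cvg_cst.
by rewrite (cvg_shiftn n); exact: is_cvg_series_exp_coeff.
Qed.

Lemma rising_sum_le m : \sum_(k < m) r k <= stirling_ratio R n - Q.
Proof.
have ndr : nondecreasing_seq (fun m => \sum_(k < m) r k).
  apply/nondecreasing_seqP => k; rewrite big_ord_recr/= lerDl.
  exact: ltW (rising_tail_gt0 k).
rewrite -(cvg_lim _ cvg_rising_sum)//; apply: nondecreasing_cvgn_le => //.
by apply/cvg_ex; eexists; exact: cvg_rising_sum.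
Qed.

(** Limit of [rising_sum_sub_mean_le] in [m], the partial sum on its right-hand side being first
    bounded by its limit. *)
Lemma stirling_ratio_ub :
  stirling_ratio R n - Q - Q <=
  2 / 3 + (5 * (stirling_ratio R n - Q) + 1) / (6 * n%:R).
Proof.
rewrite lerBlDr; apply: (cvgr_to_le cvg_rising_sum).
near=> m; rewrite -lerBlDr; apply: (le_trans (rising_sum_sub_mean_le _)).
  by near: m; exact: nbhs_infty_ge.
rewrite lerD2l ler_pM2r ?invr_gt0 ?mulr_gt0// lerD2r ler_pM2l//.
exact: rising_sum_le.
Unshelve. all: by end_near. Qed.

Lemma stirling_ratio_lb :
  2 / 3 - (5 * Q - 1) / (6 * n%:R) <= stirling_ratio R n - Q - Q.
Proof.
apply: le_trans (rising_sum_sub_mean_ge (leqnn n)) _.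
by rewrite lerD2r rising_sum_le.
Qed.

End tails.

(** * Comparison with the Gaussian integral *)

Import gauss_integral_proof.

Section gauss_sums.
Context {R : realType}.
Implicit Types x y h : R.

Lemma integral0_gauss0 : integral0_gauss 0 = 0 :> R.
Proof. by rewrite /integral0_gauss set_itv1 Rintegral_set1. Qed.

Lemma integral0_gauss_derive x : 0 < x ->
  is_derive x (1 : R) integral0_gauss (gauss_fun x).
Proof.
move=> x0.
suff [dJ J'] : derivable integral0_gauss x 1 /\ derive1 integral0_gauss x = gauss_fun x.
  by split; [|rewrite -derive1E].
apply: (@continuous_FTC1 R gauss_fun (BLeft 0) _ (x + 1)).
- by rewrite ltrDl.
- apply: continuous_compact_integrable => //; first exact: segment_compact.
  by apply: continuous_subspaceT; exact: continuous_gauss_fun.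
- by rewrite /= lte_fin.
- by move=> ?; exact: continuous_gauss_fun.
Qed.

(** Mean value theorem, [gauss_fun] being decreasing on the nonnegative half-line. *)
Lemma integral0_gauss_diff x y : 0 <= x -> x < y ->
  (y - x) * gauss_fun y <= integral0_gauss y - integral0_gauss x <=
  (y - x) * gauss_fun x.
Proof.
move=> x0 xy.
have cJ : {within `[x, y], continuous (@integral0_gauss R)}.
  apply: (@continuous_subspaceW _ _ _ `[0, y]).
    by apply: subset_itvr; rewrite bnd_simp.
  apply: parameterized_integral_continuous; first exact: le_trans (ltW xy).
  apply: continuous_compact_integrable => //; first exact: segment_compact.
  by apply: continuous_subspaceT; exact: continuous_gauss_fun.
have dJ z : z \in `]x, y[ -> is_derive z (1 : R) integral0_gauss (gauss_fun z).
  rewrite in_itv/= => /andP[xz _]; apply: integral0_gauss_derive.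
  exact: le_lt_trans xz.
have [c] := MVT xy dJ cJ; rewrite in_itv/= => /andP[xc cy] ->.
have c0 : 0 <= c by rewrite (le_trans x0)// ltW.
rewrite [gauss_fun c * _]mulrC !ler_pM2l ?subr_gt0//.
rewrite !ler_expR !lerN2 !ler_sqr ?nnegrE//; last exact: le_trans (ltW xy).
by rewrite !ltW.
Qed.

(** Square root of the limit [pi / 4] of the squared integral, which is legitimate because the
    integral is nonnegative. *)
Lemma cvg_integral0_gauss :
  integral0_gauss x @[x --> +oo] --> Num.sqrt (pi : R) / 2.
Proof.
have -> : Num.sqrt pi / 2 = Num.sqrt (pi / 4) :> R.
  rewrite sqrtrM ?pi_ge0// sqrtrV// (_ : 4 = 2 ^+ 2); last by ring.
  by rewrite sqrtr_sqr ger0_norm.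
have -> : @integral0_gauss R = fun x => Num.sqrt (integral0_gauss x ^+ 2).
  by apply/funext => x; rewrite sqrtr_sqr ger0_norm// integral0_gauss_ge0.
apply: (cvg_comp _ _ (@cvg_integral0_gauss_sqr R)).
exact: sqrt_continuous.
Qed.

Lemma integral0_gauss_le x : 0 <= x -> integral0_gauss x <= Num.sqrt pi / 2.
Proof.
move=> x0; apply: (cvgr_to_ge cvg_integral0_gauss).
near=> y; have xy : x < y by near: y; apply: nbhs_pinfty_gt; exact: num_real.
have /andP[Jxy _] := integral0_gauss_diff x0 xy.
rewrite -subr_ge0; apply: le_trans Jxy.
by rewrite mulr_ge0 ?gauss_fun_ge0// subr_ge0 ltW.
Unshelve. all: by end_near. Qed.

(** Right and left Riemann sums of a decreasing function enclose its integral. *)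
Lemma integral0_gauss_sum h m : 0 < h ->
  h * \sum_(k < m) gauss_fun (k.+1%:R * h) <= integral0_gauss (m%:R * h) <=
  h * \sum_(k < m) gauss_fun (k%:R * h).
Proof.
move=> h0; elim: m => [|m /andP[IH1 IH2]].
  by rewrite !big_ord0 mul0r mulr0 integral0_gauss0 lexx.
have mh : m%:R * h < m.+1%:R * h by rewrite ltr_pM2r// ltr_nat.
have mh0 : 0 <= m%:R * h by rewrite mulr_ge0// ltW.
have := integral0_gauss_diff mh0 mh.
rewrite -mulrBl -natr1 addrAC subrr add0r mul1r natr1 => /andP[d1 d2].
rewrite !big_ord_recr/= !mulrDr; apply/andP; split; lra.
Qed.

End gauss_sums.

Section gauss_bounds.
Context (R : realType) (n : nat) (n0 : (0 < n)%N).
Local Notation q := (gain_tail R n).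
Local Notation r := (rising_tail R n).
Local Notation Q := (gain_mean R n).

Let nR_gt0 : 0 < n%:R :> R. Proof. by rewrite ltr0n. Qed.
Let nR_neq0 : n%:R != 0 :> R. Proof. by rewrite gt_eqF. Qed.

(** The mesh for which [gauss_fun (k h)] is [exp (- k^2 / (2n))]. *)
Let h : R := (Num.sqrt (2 * n%:R))^-1.

Let h_gt0 : 0 < h.
Proof. by rewrite invr_gt0 sqrtr_gt0 mulr_gt0. Qed.

Let gauss_h k : gauss_fun (k%:R * h) = expR (- (k%:R ^+ 2 / (2 * n%:R))).
Proof.
rewrite /gauss_fun exprMn /h exprVn sqr_sqrtr// mulr_ge0//.
Qed.

Let sqrt_h : h^-1 * (Num.sqrt pi / 2) = Num.sqrt (pi * n%:R / 2).
Proof.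
have -> : pi * n%:R / 2 = pi * (2 * n%:R) / 2 ^+ 2 :> R by field.
rewrite sqrtrM ?sqrtrV ?sqrtr_sqr ?mulr_ge0 ?pi_ge0//.
rewrite sqrtrM ?pi_ge0// ger0_norm// /h invrK; ring.
Qed.

(** From [1 - x <= exp (- x)] and [sum_(j <= k) j / n >= k^2 / (2n)]. *)
Lemma gain_tail_le_gauss k : q k <= expR (- (k%:R ^+ 2 / (2 * n%:R))).
Proof.
elim: k => [|k IH]; first by rewrite gain_tail0 expr0n/= mul0r oppr0 expR0.
rewrite gain_tailS.
apply: (@le_trans _ _ (expR (- (k%:R ^+ 2 / (2 * n%:R))) * expR (- (k.+1%:R / n%:R)))).
  (* For [k + 1 > n] the factor is negative and cannot be multiplied through; the left-hand side is
     then at most [0]. *)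
  have [c1|c1] := leP (k.+1%:R / n%:R) (1 : R).
    by rewrite ler_pM ?gain_tail_ge0 ?subr_ge0 ?expR_ge1Dx.
  rewrite (@le_trans _ _ 0)// ?mulr_ge0 ?expR_ge0//.
  by rewrite mulr_ge0_le0 ?gain_tail_ge0// subr_le0 ltW.
rewrite -expRD ler_expR -opprD lerN2.
have -> : k%:R ^+ 2 / (2 * n%:R) + k.+1%:R / n%:R =
    (k%:R ^+ 2 + 2 * k.+1%:R) / (2 * n%:R) :> R by field.
rewrite ler_pM2r ?invr_gt0 ?mulr_gt0// -natr1; lra.
Qed.

(** From [1 + x <= exp x] and [sum_(j <= k) j / n <= (k + 1)^2 / (2n)]; the shift to [k + 1] lets
    the bound serve as a shifted Riemann sum. *)
Lemma rising_tail_ge_gauss k : expR (- (k.+1%:R ^+ 2 / (2 * n%:R))) <= r k.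
Proof.
elim: k => [|k IH].
  by rewrite rising_tail0 -expR0 ler_expR oppr_le0 divr_ge0// ?exprn_ge0 ?mulr_ge0.
rewrite rising_tailS ler_pdivlMr ?ltr_pwDl ?divr_ge0//.
apply: le_trans IH.
apply: (@le_trans _ _ (expR (- (k.+2%:R ^+ 2 / (2 * n%:R))) * expR (k.+1%:R / n%:R))).
  by rewrite ler_wpM2l ?expR_ge0// expR_ge1Dx.
rewrite -expRD ler_expR.
have -> : - (k.+2%:R ^+ 2 / (2 * n%:R)) + k.+1%:R / n%:R =
    - ((k.+2%:R ^+ 2 - 2 * k.+1%:R) / (2 * n%:R)) :> R by field.
rewrite lerN2 ler_pM2r ?invr_gt0 ?mulr_gt0// -[k.+2%:R]natr1; lra.
Qed.

(** The term [k = 0] contributes the [1]; the others are dominated by a right Riemann sum, hence by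
    the full Gaussian integral. *)
Lemma gain_mean_le : Q <= 1 + Num.sqrt (pi * n%:R / 2).
Proof.
rewrite /gain_mean -(prednK n0) big_ord_recl /= prednK// gain_tail0 lerD2l.
rewrite -sqrt_h ler_pdivlMl//.
apply: le_trans (integral0_gauss_le (mulr_ge0 (ler0n R n.-1) (ltW h_gt0))).
have /andP[+ _] := integral0_gauss_sum n.-1 h_gt0.
apply: le_trans; rewrite ler_pM2l//; apply: ler_sum => k _.
by rewrite gauss_h gain_tail_le_gauss.
Qed.

(** The left Riemann sum dominates the integral. Its term at [0], equal to [1], has no counterpart
    among the shifted lower bounds, whence the [- 1]. *)
Lemma stirling_ratio_sub_mean_ge :
  Num.sqrt (pi * n%:R / 2) - 1 <= stirling_ratio R n - Q.
Proof.
rewrite lerBlDr -sqrt_h ler_pdivrMl//.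
have cJ : integral0_gauss (m.+1%:R * h) @[m --> \oo] --> Num.sqrt (pi : R) / 2.
  apply: (cvg_comp (fun m : nat => m.+1%:R * h) _ _ cvg_integral0_gauss).
  apply/cvgryPge => A; near=> m; rewrite -ler_pdivrMr//.
  apply: (@le_trans _ _ m%:R); last by rewrite ler_nat.
  by near: m; exact: nbhs_infty_ger.
apply: (cvgr_to_le cJ); near=> m.
have /andP[_ +] := integral0_gauss_sum m.+1 h_gt0.
move=> /le_trans; apply; rewrite ler_pM2l//.
rewrite big_ord_recl /= gauss_h expr0n/= mul0r oppr0 expR0 addrC lerD2r.
apply: le_trans (rising_sum_le _ n0 m); apply: ler_sum => k _.
by rewrite gauss_h rising_tail_ge_gauss.
Unshelve. all: by end_near. Qed.

End gauss_bounds.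

(** * Rate of convergence in Stirling's formula *)

Section ln_bounds.
Context {R : realType}.
Implicit Types t x y : R.

Lemma derive_ge0_ge0 (f df : R -> R) (a y : R) :
  (forall x, a <= x -> is_derive x (1 : R) f (df x)) ->
  (forall x, a <= x -> 0 <= df x) -> f a = 0 -> a <= y -> 0 <= f y.
Proof.
move=> fdf df0 fa ay.
have [||c] := @MVT_segment R f df a y ay.
- by move=> x; rewrite in_itv/= => /andP[ax _]; apply: fdf; exact: ltW.
- apply: derivable_within_continuous => x; rewrite in_itv/= => /andP[ax _].
  by have [] := fdf _ ax.
rewrite in_itv/= fa subr0 => /andP[ac _] ->.
by rewrite mulr_ge0 ?df0// subr_ge0.
Qed.

Lemma ln_ge_ratio y : 1 <= y -> 2 * (y - 1) <= (y + 1) * ln y.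
Proof.
move=> y1; rewrite -subr_ge0.
pose f : R -> R := (@id R + cst 1) * @ln R - 2 \*: (@id R - cst 1).
pose df x : R := (x + 1) * x^-1 + ln x - 2.
suff : 0 <= f y by [].
refine (@derive_ge0_ge0 f df 1 y _ _ _ y1) => [x x1|x x1|].
- have x0 : 0 < x by lra.
  have dln := is_derive1_ln x0.
  apply: is_derive_eq; rewrite /df /= !fctE.
  rewrite -![_ *: _]/(_ * _); ring.
- have x0 : 0 < x by lra.
  have x1V : ln x^-1 <= x^-1 - 1.
    rewrite -{1}[x^-1](subrKC 1); apply: le_ln1Dx.
    by rewrite ltrBrDl subrr invr_gt0.
  rewrite lnV ?posrE// in x1V.
  by rewrite /df mulrDl mul1r divff ?gt_eqF//; lra.
- by rewrite /f !fctE /= ln1 subrr mulr0 scaler0 subr0.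
Qed.

(** The difference of the two sides vanishes at [1] and has derivative [(x - 1)^3 / x]. *)
Lemma ln_le_cubic y : 1 <= y ->
  ln y <= (y - 1) - (y - 1) ^+ 2 / 2 + (y - 1) ^+ 3 / 3.
Proof.
move=> y1; rewrite -subr_ge0.
pose g : R -> R := @id R - cst 1.
pose f : R -> R := g - 2^-1 \*: g ^+ 2 + 3^-1 \*: g ^+ 3 - @ln R.
pose df x : R := 1 - (x - 1) + (x - 1) ^+ 2 - x^-1.
suff : 0 <= f y.
  by rewrite /f /g !fctE /= -![_ *: _]/(_ * _) [2^-1 * _]mulrC [3^-1 * _]mulrC.
refine (@derive_ge0_ge0 f df 1 y _ _ _ y1) => [x x1|x x1|].
- have x0 : 0 < x by lra.
  have dln := is_derive1_ln x0.
  apply: is_derive_eq; rewrite /df /g /= !fctE.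
  rewrite -![_ *: _]/(_ * _); field.
  by rewrite gt_eqF.
- have x0 : 0 < x by lra.
  have -> : df x = (x - 1) ^+ 3 / x by rewrite /df; field; rewrite gt_eqF.
  by rewrite divr_ge0 ?exprn_ge0 ?subr_ge0// ltW.
- by rewrite /f /g !fctE /= subrr !expr0n/= !scaler0 ln1; ring.
Qed.

End ln_bounds.

(** * Monotonicity of the logarithm of the Stirling ratio *)

Section stirling.
Context (R : realType).

Let L (n : nat) : R := ln (stirling_ratio R n) - ln n%:R / 2.

Let LE n : (0 < n)%N -> L n = ln n`!%:R - n%:R * ln n%:R + n%:R - ln n%:R / 2.
Proof.
move=> n0; have nR : 0 < n%:R :> R by rewrite ltr0n.
rewrite /L /stirling_ratio lnM ?posrE ?expR_gt0 ?divr_gt0 ?exprn_gt0 ?ltr0n ?fact_gt0//.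
by rewrite ln_div ?posrE ?exprn_gt0 ?ltr0n ?fact_gt0// lnXn// expRK mulr_natl.
Qed.

Let L_diff n : (0 < n)%N ->
  L n - L n.+1 = (n%:R + 2^-1) * ln (1 + n%:R^-1) - 1.
Proof.
move=> n0; have nR : 0 < n%:R :> R by rewrite ltr0n.
rewrite !LE// factS natrM lnM ?posrE ?ltr0n ?fact_gt0//.
have -> : 1 + n%:R^-1 = n.+1%:R / n%:R :> R.
  by rewrite -natr1 mulrDl divff ?gt_eqF// mul1r.
rewrite ln_div ?posrE ?ltr0n//.
by move: (ln n.+1%:R) => l; rewrite -natr1; field.
Qed.

(** This is [ln_ge_ratio] at [1 + 1/n], scaled by [n / 2]. *)
Let L_decr n : (0 < n)%N -> L n.+1 <= L n.
Proof.
move=> n0; have nR : 0 < n%:R :> R by rewrite ltr0n.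
rewrite -subr_ge0 L_diff// subr_ge0.
have n1 : 1 <= 1 + n%:R^-1 :> R by rewrite lerDl invr_ge0.
have := ln_ge_ratio n1; move: (ln _) => l lb.
have := ler_wpM2r (ltW (divr_gt0 nR (ltr0Sn R 1))) lb.
have -> : 2 * (1 + n%:R^-1 - 1) * (n%:R / 2) = 1 :> R by field; rewrite gt_eqF.
have -> // : (1 + n%:R^-1 + 1) * l * (n%:R / 2) = (n%:R + 2^-1) * l :> R.
by field; rewrite gt_eqF.
Qed.

(** The cubic bound on [ln (1 + 1/n)] reduces the claim to [6 n^2 >= (n + 2) (n + 1)], true for
    [n >= 1]. *)
Let L_incr n : (0 < n)%N ->
  L n - (2 * n%:R)^-1 <= L n.+1 - (2 * n.+1%:R)^-1.
Proof.
move=> n0; have nR : 0 < n%:R :> R by rewrite ltr0n.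
have n1 : 1 <= 1 + n%:R^-1 :> R by rewrite lerDl invr_ge0.
suff : L n - L n.+1 <= (2 * n%:R)^-1 - (2 * n.+1%:R)^-1.
  by move: (L n) (L n.+1) (2 * n%:R)^-1 (2 * n.+1%:R)^-1 => *; lra.
rewrite L_diff//.
have := ln_le_cubic n1; move: (ln _) => l.
rewrite [1 + _]addrC addrK => lb.
apply: (@le_trans _ _ ((n%:R + 2^-1) *
   (n%:R^-1 - n%:R^-1 ^+ 2 / 2 + n%:R^-1 ^+ 3 / 3) - 1)).
  by rewrite lerD2r ler_pM2l// addr_gt0.
rewrite -subr_ge0 -[n.+1%:R]natr1.
have -> : (2 * n%:R)^-1 - (2 * (n%:R + 1))^-1 -
   ((n%:R + 2^-1) * (n%:R^-1 - n%:R^-1 ^+ 2 / 2 + n%:R^-1 ^+ 3 / 3) - 1)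
  = (6 * n%:R ^+ 2 - (n%:R + 2) * (n%:R + 1))
     / (12 * n%:R ^+ 3 * (n%:R + 1)) :> R.
  by field; rewrite natr1 pnatr_eq0 (gt_eqF nR).
apply: divr_ge0; last by rewrite !mulr_ge0 ?exprn_ge0 ?addr_ge0.
have : 1 <= n%:R :> R by rewrite ler1n.
move: (n%:R : R) => x x1; nra.
Qed.

(* Once the limit of n!e^n/n^n / sqrt n is known, the monotonicity of its
   logarithm and of the corrected logarithm gives the rate of convergence. *)
Lemma stirling_ratio_bounds (c : R) : 0 < c ->
  stirling_ratio R n / Num.sqrt n%:R @[n --> \oo] --> c ->
  forall n, (0 < n)%N ->
  c * Num.sqrt n%:R <= stirling_ratio R n <=
  c * Num.sqrt n%:R * expR (2 * n%:R)^-1.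
Proof.
move=> c0 cvgc n n0.
have a0 k : (0 < k)%N -> 0 < stirling_ratio R k.
  by move=> k0; rewrite mulr_gt0 ?expR_gt0 ?divr_gt0 ?exprn_gt0 ?ltr0n ?fact_gt0.
have LlnE k : (0 < k)%N -> L k = ln (stirling_ratio R k / Num.sqrt k%:R).
  move=> k0; rewrite ln_div ?posrE ?a0 ?sqrtr_gt0 ?ltr0n//.
  congr (_ - _); rewrite -[in LHS](sqr_sqrtr (ler0n R k)) lnXn ?sqrtr_gt0 ?ltr0n//.
  by rewrite -[ln _ *+ 2]mulr_natr mulfK.
have cvgL : L k @[k --> \oo] --> ln c.
  have := cvg_comp _ _ cvgc (continuous_ln c0).
  apply: cvg_trans; apply: near_eq_cvg; near=> k.
  by rewrite LlnE//; near: k; exact: nbhs_infty_gt.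
have Lge k : (n <= k)%N -> L k <= L n.
  elim: k => [|k IH]; first by rewrite leqn0 => /eqP->.
  rewrite leq_eqVlt => /predU1P[->//|]; rewrite ltnS => nk.
  by apply: le_trans (IH nk); apply: L_decr; exact: leq_trans nk.
have Lle k : (n <= k)%N -> L n - (2 * n%:R)^-1 <= L k - (2 * k%:R)^-1.
  elim: k => [|k IH]; first by rewrite leqn0 => /eqP->.
  rewrite leq_eqVlt => /predU1P[->//|]; rewrite ltnS => nk.
  by apply: le_trans (IH nk) _; apply: L_incr; exact: leq_trans nk.
have lnc_le : ln c <= L n.
  by apply: (cvgr_to_le cvgL); near=> k; apply: Lge; near: k; exact: nbhs_infty_ge.
have lnc_ge : L n - (2 * n%:R)^-1 <= ln c.
  apply: (cvgr_to_ge cvgL); near=> k; apply: le_trans (Lle k _) _.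
    by near: k; exact: nbhs_infty_ge.
  by rewrite gerBl invr_ge0 mulr_ge0.
have s0 : 0 < Num.sqrt n%:R :> R by rewrite sqrtr_gt0 ltr0n.
have aE : stirling_ratio R n = expR (L n) * Num.sqrt n%:R.
  by rewrite LlnE// lnK ?posrE ?divr_gt0 ?a0// divfK// gt_eqF.
rewrite aE ler_pM2r// mulrAC ler_pM2r// -{1 2}(lnK c0) -expRD !ler_expR lnc_le/=.
by rewrite -lerBlDr.
Unshelve. all: by end_near. Qed.

End stirling.

(** * Asymptotics of the mean and of the variance *)

Section gain_mean_asymptotics.
Context (R : realType).
Local Notation Q := (gain_mean R).
Local Notation a := (stirling_ratio R).
Local Notation w := (fun n : nat => (Num.sqrt n%:R)^-1 : R).

Let sigma : R := Num.sqrt (pi / 2).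

Let sigma_gt0 : 0 < sigma.
Proof. by rewrite sqrtr_gt0 divr_gt0// pi_gt0. Qed.

Let sqrtE n : Num.sqrt (pi * n%:R / 2) = sigma * Num.sqrt n%:R :> R.
Proof. by rewrite mulrAC sqrtrM// divr_ge0// pi_ge0. Qed.

Lemma cvg_invr_sqrtn : w n @[n --> \oo] --> (0 : R).
Proof.
apply/gtr0_cvgV0.
  near=> n; rewrite sqrtr_gt0 ltr0n; near: n; exact: nbhs_infty_gt.
apply/cvgryPge => A; near=> n.
rewrite (le_trans (ler_norm _))// -sqrtr_sqr ler_sqrt//.
by near: n; exact: nbhs_infty_ger.
Unshelve. all: by end_near. Qed.

Let sqrtn_gt0 n : (0 < n)%N -> 0 < Num.sqrt n%:R :> R.
Proof. by move=> n0; rewrite sqrtr_gt0 ltr0n. Qed.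

(** With [R = a n - Q n] this is the error in [R - Q = 2/3 + o(1)]. *)
Let defect n : R := a n - Q n - Q n - 2 / 3.

Let defect_le n : (4 < n)%N ->
  `|defect n| <= (21 + 10 * (sigma * Num.sqrt n%:R)) / (6 * n%:R).
Proof.
move=> n5; have n0 : (0 < n)%N by apply: leq_trans n5.
have := gain_mean_le R n0; have := stirling_ratio_ub R n0.
have := stirling_ratio_lb R n0; rewrite sqrtE /defect.
have Q0 : 0 <= Q n by apply: sumr_ge0 => k _; exact: gain_tail_ge0.
have : 5 <= n%:R :> R by rewrite (ler_nat R 5).
have s0 : 0 <= sigma * Num.sqrt n%:R by rewrite mulr_ge0 ?ltW ?sqrtn_gt0.
move: (a n) (Q n) (n%:R : R) (sigma * _) Q0 s0 => a' q x s Q0 s0 x5 lb ub qs.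
have x0 : 0 < 6 * x by lra.
set R' := a' - q in ub lb *.
(* The upper bound on [R' - q] itself contains [R']. Since [6 x >= 30], the term [5 R'] can be
   absorbed, which leaves a bound in [q] alone. *)
have Rub : R' <= 2 * q + 2.
  have : (R' - q - 2 / 3) * (6 * x) <= 5 * R' + 1.
    by rewrite -ler_pdivlMr//; lra.
  have [//|Rq] := leP R' (2 * q + 2).
  have : 30 * (R' - q - 2 / 3) <= (R' - q - 2 / 3) * (6 * x).
    by rewrite mulrC ler_wpM2l; lra.
  lra.
rewrite ler_norml; apply/andP; split.
  rewrite -mulNr ler_pdivrMr//.
  have : (2 / 3 - (R' - q)) * (6 * x) <= 5 * q - 1.
    by rewrite -ler_pdivlMr//; lra.
  lra.
rewrite ler_pdivlMr//.
have : (R' - q - 2 / 3) * (6 * x) <= 5 * R' + 1.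
  by rewrite -ler_pdivlMr//; lra.
lra.
Qed.

Let cvg_defect : defect n @[n --> \oo] --> 0.
Proof.
apply: norm_cvg0.
have cB : 21 / 6 * (w n * w n) + 10 / 6 * sigma * w n @[n --> \oo] --> (0 : R).
  have -> : 0 = 21 / 6 * (0 * 0) + 10 / 6 * sigma * 0 :> R by ring.
  apply: cvgD; apply: cvgM; try exact: cvg_cst; try exact: cvg_invr_sqrtn.
  by apply: cvgM; exact: cvg_invr_sqrtn.
apply: (squeeze_cvgr _ (cvg_cst 0) cB); near=> n.
have n5 : (4 < n)%N by near: n; exact: nbhs_infty_gt.
rewrite normr_ge0/=; apply: le_trans (defect_le n5) _.
have u0 : Num.sqrt n%:R != 0 :> R by rewrite gt_eqF// sqrtn_gt0// (leq_trans _ n5).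
rewrite -[X in 6 * X](sqr_sqrtr (ler0n R n)).
by rewrite le_eqVlt; apply/orP; left; apply/eqP; field.
Unshelve. all: by end_near. Qed.

(** Squeeze: [a = 2 Q + 2/3 + defect] with the upper bound on [Q], and [a = 2 R - 2/3 - defect] with
    the lower bound on [R]. The limit is [sqrt (2 pi)]. *)
Let cvg_stirling_ratio : a n / Num.sqrt n%:R @[n --> \oo] --> 2 * sigma.
Proof.
have cl : 2 * sigma + 2 * w n + defect n * w n + 2 / 3 * w n @[n --> \oo] --> 2 * sigma.
  rewrite [X in _ --> X](_ : _ = 2 * sigma + 2 * 0 + 0 * 0 + 2 / 3 * 0); last by ring.
  apply: cvgD; last by apply: cvgM; [exact: cvg_cst|exact: cvg_invr_sqrtn].
  apply: cvgD; last by apply: cvgM; [exact: cvg_defect|exact: cvg_invr_sqrtn].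
  apply: cvgD; first exact: cvg_cst.
  by apply: cvgM; [exact: cvg_cst|exact: cvg_invr_sqrtn].
have cu : 2 * sigma - 2 * w n - defect n * w n - 2 / 3 * w n @[n --> \oo] --> 2 * sigma.
  rewrite [X in _ --> X](_ : _ = 2 * sigma - 2 * 0 - 0 * 0 - 2 / 3 * 0); last by ring.
  apply: cvgB; last by apply: cvgM; [exact: cvg_cst|exact: cvg_invr_sqrtn].
  apply: cvgB; last by apply: cvgM; [exact: cvg_defect|exact: cvg_invr_sqrtn].
  apply: cvgB; first exact: cvg_cst.
  by apply: cvgM; [exact: cvg_cst|exact: cvg_invr_sqrtn].
apply: (squeeze_cvgr _ cu cl); near=> n.
have n0 : (0 < n)%N by near: n; exact: nbhs_infty_gt.
have u0 := sqrtn_gt0 n0; have u0' : Num.sqrt n%:R != 0 :> R by rewrite gt_eqF.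
have := gain_mean_le R n0; have := stirling_ratio_sub_mean_ge R n0.
rewrite sqrtE ler_pdivlMr// ler_pdivrMr// /defect.
move: (a n) (Q n) (Num.sqrt _) u0' u0 => a' q u u0' u0 lb ub.
have -> : (2 * sigma - 2 / u - (a' - q - q - 2 / 3) / u - 2 / 3 / u) * u =
   2 * (sigma * u) - 2 - (a' - q - q - 2 / 3) - 2 / 3 by field.
have -> : (2 * sigma + 2 / u + (a' - q - q - 2 / 3) / u + 2 / 3 / u) * u =
   2 * (sigma * u) + 2 + (a' - q - q - 2 / 3) + 2 / 3 by field.
by apply/andP; split; lra.
Unshelve. all: by end_near. Qed.

(** Solving the definition of [defect] for [Q] gives [Q = a/2 - defect/2 - 1/3]. *)
Lemma gain_mean_asymptotics :
  Q n - Num.sqrt (pi * n%:R / 2) @[n --> \oo] --> - (3^-1 : R).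
Proof.
have cst : a n - 2 * sigma * Num.sqrt n%:R @[n --> \oo] --> (0 : R).
  have cB : 2 * sigma * w n @[n --> \oo] --> (0 : R).
    have -> : 0 = 2 * sigma * 0 :> R by ring.
    by apply: cvgM; [exact: cvg_cst|exact: cvg_invr_sqrtn].
  (* The Stirling bounds put the difference between [0] and
     [2 sigma sqrt n / n = 2 sigma / sqrt n]. *)
  apply: (squeeze_cvgr _ (cvg_cst 0) cB); near=> n.
  have n0 : (0 < n)%N by near: n; exact: nbhs_infty_gt.
  have s0 : 0 < 2 * sigma by rewrite mulr_gt0.
  have /andP[lb ub] := stirling_ratio_bounds s0 cvg_stirling_ratio n0.
  rewrite subr_ge0 lb/= lerBlDl; apply: le_trans ub _.
  have u0 := sqrtn_gt0 n0.
  have nR : 0 < n%:R :> R by rewrite ltr0n.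
  have nR1 : 1 <= n%:R :> R by rewrite ler1n.
  (* [e^x <= 1/(1-x) <= 1 + 2x] for [x = 1/(2n)] *)
  have e2 : expR (2 * n%:R)^-1 <= 1 + n%:R^-1 :> R.
    have -> : n%:R^-1 = 2 * (2 * n%:R)^-1 :> R by field; rewrite gt_eqF.
    have x0 : 0 <= (2 * n%:R)^-1 :> R by rewrite invr_ge0 mulr_ge0.
    have x1 : (2 * n%:R)^-1 <= 2^-1 :> R by rewrite lef_pV2 ?posrE ?mulr_gt0//; lra.
    move: (2 * n%:R)^-1 x0 x1 => x x0 x1.
    have := expR_ge1Dx (- x).
    rewrite expRN -(ler_pM2l (expR_gt0 x)) mulfV ?gt_eqF ?expR_gt0// => e1.
    rewrite -(@ler_pM2r _ (1 - x)); last by lra.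
    by apply: le_trans e1 _; nra.
  apply: (@le_trans _ _ (2 * sigma * Num.sqrt n%:R * (1 + n%:R^-1))).
    by rewrite ler_wpM2l// mulr_ge0// ltW.
  rewrite mulrDr mulr1 lerD2l -mulrA ler_wpM2l ?(ltW s0)//.
  rewrite -{2}(sqr_sqrtr (ler0n R n)).
  by rewrite le_eqVlt; apply/orP; left; apply/eqP; field; rewrite gt_eqF.
have -> : - 3^-1 = 2^-1 * 0 - 2^-1 * 0 - 3^-1 :> R by ring.
have -> : (fun n => Q n - Num.sqrt (pi * n%:R / 2)) =
    (fun n => 2^-1 * (a n - 2 * sigma * Num.sqrt n%:R) - 2^-1 * defect n - 3^-1).
  by apply/funext => n; rewrite sqrtE /defect; field.
apply: cvgB; last exact: cvg_cst.
by apply: cvgB; (apply: cvgM; first exact: cvg_cst).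
Unshelve. all: by end_near. Qed.

(* The terms of order [sqrt n] cancel: [Q n = sigma * sqrt n - 1/3 + o(1)] and
   [sigma^2 = pi / 2]. *)
Lemma gain_variance_asymptotics :
  Num.sqrt n%:R * (2 - Q n / n%:R - Q n ^+ 2 / n%:R
    - (2 - pi / 2 - Num.sqrt (pi / (18 * n%:R)))) @[n --> \oo] --> (0 : R).
Proof.
pose delta n : R := Q n - Num.sqrt (pi * n%:R / 2).
(* This is [0], written in the shape that the limit rules produce for the expanded expression
   below. *)
pose l : R := - (- 3^-1 * 0) - 2 * sigma * (- 3^-1 + 3^-1)
  - (- 3^-1) * (- 3^-1) * 0.
rewrite [X in _ --> X](_ : _ = l); last by rewrite /l; ring.
have cd : - (delta n * w n) - 2 * sigma * (delta n + 3^-1)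
    - delta n * delta n * w n @[n --> \oo] --> l.
  have cD : delta n @[n --> \oo] --> - (3^-1 : R) := gain_mean_asymptotics.
  apply: cvgB.
    apply: cvgB.
      by apply: cvgN; apply: cvgM => //; exact: cvg_invr_sqrtn.
    by apply: cvgM; [exact: cvg_cst|apply: cvgD => //; exact: cvg_cst].
  apply: cvgM; last exact: cvg_invr_sqrtn.
  exact: cvgM.
move: cd; apply: cvg_trans; apply: near_eq_cvg; near=> n.
have n0 : (0 < n)%N by near: n; exact: nbhs_infty_gt.
have u0 := sqrtn_gt0 n0; have u0' : Num.sqrt n%:R != 0 :> R by rewrite gt_eqF.
have -> : Num.sqrt (pi / (18 * n%:R)) = sigma / 3 / Num.sqrt n%:R :> R.
  have -> : pi / (18 * n%:R) = pi / 2 / 3 ^+ 2 / n%:R :> R.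
    by field; rewrite pnatr_eq0 -lt0n.
  rewrite sqrtrM ?divr_ge0 ?exprn_ge0 ?pi_ge0// sqrtrM ?divr_ge0 ?pi_ge0//.
  by rewrite !sqrtrV// ?exprn_ge0// sqrtr_sqr ger0_norm.
have sE : pi / 2 = sigma ^+ 2 by rewrite sqr_sqrtr// divr_ge0// pi_ge0.
have QE : Q n = delta n + sigma * Num.sqrt n%:R by rewrite /delta sqrtE subrK.
rewrite sE QE; move: (delta n) (sqr_sqrtr (ler0n R n)) => e.
by move: (Num.sqrt n%:R) u0' => u u0' <-; field.
Unshelve. all: by end_near. Qed.

End gain_mean_asymptotics.

Theorem proposition5p2 (R : realType)
    (d : nat -> measure_display) (T : forall n : nat, measurableType (d n))
    (P : forall n : nat, probability (T n) R)
    (X : forall n : nat, nat -> {RV (P n) >-> nat})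
    (X_uniform : forall n k : nat, (1 <= n)%N -> (1 <= k)%N ->
       uniform_upto (P n) n (X n k))
    (X_indep : forall n : nat, (1 <= n)%N ->
       mutually_independent (P n) [set k : nat | (1 <= k)%N] (X n)) :
  let G (n : nat) (w : T n) : R := (gain (X n) n w)%:R in
  let v (n : nat) : R := fine 'V_(P n)[fun w => G n w / Num.sqrt n%:R] in
  [/\ forall n : nat, (1 <= n)%N ->
        'V_(P n)[fun w => G n w / Num.sqrt n%:R] = (v n)%:E /\
        ('V_(P n)[G n] * (n%:R^-1)%:E)%E = (v n)%:E,
      (fun n : nat => v n - (2 - pi / 2 - Num.sqrt (pi / (18 * n%:R))))
        =o_\oo (fun n : nat => 1 / Num.sqrt n%:R)
    & v n @[n --> \oo] --> 2 - pi / 2].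
Proof.
move=> G v.
have VG n : (1 <= n)%N -> 'V_(P n)[G n] =
    (2 * n%:R - gain_mean R n - gain_mean R n ^+ 2)%:E.
  move=> n0; rewrite -(gain_sqr_mean R n0); apply: variance_gain => //.
  - by move=> k k0; exact: X_uniform.
  - exact: X_indep.
have VGs n : (1 <= n)%N ->
    'V_(P n)[fun w => G n w / Num.sqrt n%:R] = ((n%:R^-1)%:E * 'V_(P n)[G n])%E.
  move=> n0; rewrite -[n%:R in RHS](sqr_sqrtr (ler0n R n)) -exprVn -varianceZ//.
  by apply: gain_Lfun2 => //; exact: X_indep.
have vE n : (1 <= n)%N ->
    v n = 2 - gain_mean R n / n%:R - gain_mean R n ^+ 2 / n%:R.
  move=> n0; rewrite /v VGs// VG//=.
  by field; rewrite pnatr_eq0 -lt0n.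
have cv := @gain_variance_asymptotics R.
split.
- move=> n n0; rewrite muleC -VGs//; split=> //.
    by rewrite /v VGs// VG// -EFinM.
  by rewrite /v VGs// VG// -EFinM.
(* After multiplication by [sqrt n], the little-o claim is the convergence to [0] in [cv]. *)
- apply/eqoP => e e0; near=> n.
  have n0 : (0 < n)%N by near: n; exact: nbhs_infty_gt.
  have u0 : 0 < Num.sqrt n%:R :> R by rewrite sqrtr_gt0 ltr0n.
  rewrite vE// div1r normfV ler_pdivlMr ?normr_gt0 ?gt_eqF// -normrM mulrC.
  near: n; exact: (cvgr0_norm_le _ cv).
(* Eventually [v n] equals its expansion plus the scaled remainder of [cv] divided by [sqrt n];
   every term after [2 - pi / 2] tends to [0]. *)
- have cl : 2 - pi / 2 - Num.sqrt (pi / 18) / Num.sqrt n%:R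
      + Num.sqrt n%:R * (2 - gain_mean R n / n%:R - gain_mean R n ^+ 2 / n%:R
        - (2 - pi / 2 - Num.sqrt (pi / (18 * n%:R)))) / Num.sqrt n%:R
      @[n --> \oo] --> (2 - pi / 2 - Num.sqrt (pi / 18) * 0 + 0 * 0 : R).
    apply: cvgD; last by apply: cvgM; [exact: cv|exact: cvg_invr_sqrtn].
    apply: cvgB; first exact: cvg_cst.
    by apply: cvgM; [exact: cvg_cst|exact: cvg_invr_sqrtn].
  rewrite !mulr0 addr0 subr0 in cl.
  move: cl; apply: cvg_trans; apply: near_eq_cvg; near=> n.
  have n0 : (0 < n)%N by near: n; exact: nbhs_infty_gt.
  have u0 : Num.sqrt n%:R != 0 :> R by rewrite gt_eqF// sqrtr_gt0 ltr0n.
  rewrite vE// [Num.sqrt n%:R * _]mulrC mulfK//.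
  have -> : Num.sqrt (pi / (18 * n%:R)) = Num.sqrt (pi / 18) / Num.sqrt n%:R :> R.
    by rewrite invfM mulrA sqrtrM ?divr_ge0 ?pi_ge0// sqrtrV.
  by ring.
Unshelve. all: by end_near. Qed.
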